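(* Let $D$ be a local integral domain with nonprincipal maximal ideal $M$, and assume that $D$ is not a valuation domain. Then $D$ is a divisorial domain if and only if $(M:M)$ is a 2-generated $D$-module and $M$ is an $m$-canonical ideal of $(M:M)$.
   Context: ''Local'' means having a unique maximal ideal; no Noetherian hypothesis is assumed. Let $K$ be the quotient field of $D$. For $D$-submodules (e.g. fractional ideals) $I,J$ of $K$, $(I:J)=\{x\in K\mid xJ\subseteq I\}$; in particular $(M:M)=\{x\in K\mid xM\subseteq M\}$ is an overring of $D$ having $M$ as an ideal. For a nonzero fractional ideal $I$ of $D$, $I^{-1}=(D:I)$ and $I_v=(I^{-1})^{-1}$; $I$ is divisorial if $I=I_v$. A domain $D$ is divisorial if each of its nonzero ideals is divisorial. A nonzero ideal $I$ of a domain $R$ is called $m$-canonical (in $R$) if $(I:(I:J))=J$ for each nonzero ideal $J$ of $R$, colons being taken in the quotient field of $R$. A module is 2-generated if it can be generated by two elements. *)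

(* Defs.v *)
From mathcomp Require Import all_boot all_order all_algebra.
From mathcomp Require Import generic_quotient boolp classical_sets.

Set Implicit Arguments.
Unset Strict Implicit.
Unset Printing Implicit Defensive.

Import GRing.Theory.
Local Open Scope ring_scope.
Local Open Scope quotient_scope.
Local Open Scope classical_set_scope.

(* Domains, overrings, ideals and submodules all live as subsets of one fixed
   field K.  Ideals are [set K] rather than boolean predicates so that
   "for each ideal" ranges over arbitrary ideals.  In the definitions below,
   [R] is meant to be a subring of K whose quotient field is K. *)

(* D, seen inside its quotient field. *)
Definition in_frac (D : idomainType) : set {fraction D} := range (@tofrac D).
Arguments in_frac D : clear implicits.

Section Subrings.
Variable K : fieldType.
Implicit Types R I J M N : set K.

Definition has_quotient_field R : Prop :=
  forall x : K, exists a b, [/\ R a, R b, b != 0 & x = a / b].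

Definition submodule R I : Prop :=
  [/\ I 0, forall x y, I x -> I y -> I (x + y)
    & forall r x, R r -> I x -> I (r * x)].

(* The zero ideal and R itself are allowed. *)
Definition ideal R I : Prop := I `<=` R /\ submodule R I.

Definition maximal_ideal R M : Prop :=
  [/\ ideal R M, M <> R
    & forall J, ideal R J -> M `<=` J -> J = M \/ J = R].

(* No Noetherian hypothesis. *)
Definition local_domain R : Prop := exists! M, maximal_ideal R M.

Definition principal R I : Prop := exists2 a, R a & I = [set r * a | r in R].

Definition valuation_domain R : Prop := forall x : K, x != 0 -> R x \/ R x^-1.

Definition colon I J : set K := [set x | forall y, J y -> I (x * y)].

Definition inv_ideal R I : set K := colon R I.
Definition v_closure R I : set K := inv_ideal R (inv_ideal R I).
Definition divisorial R I : Prop := I = v_closure R I.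

Definition divisorial_domain R : Prop :=
  forall I, ideal R I -> I <> [set 0] -> divisorial R I.

Definition m_canonical R I : Prop :=
  [/\ ideal R I, I <> [set 0]
    & forall J, ideal R J -> J <> [set 0] -> colon I (colon I J) = J].

Definition two_generated R N : Prop :=
  exists a b, N = [set r * a + s * b | r in R & s in R].

(* The next two facts justify computing the colons for (M : M) in K. *)
Lemma overring_quotient_field R R' :
  has_quotient_field R -> R `<=` R' -> has_quotient_field R'.
Proof.
by move=> qR sRR' x; have [a [b [Ra Rb b0 ->]]] := qR x; exists a, b; split; auto.
Qed.

Lemma ideal_colon_overring R M : ideal R M -> R `<=` colon M M.
Proof. by move=> [_ [_ _ RM]] r Rr x Mx; exact: RM. Qed.

End Subrings.

Lemma in_frac_quotient_field (D : idomainType) :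
  has_quotient_field (in_frac D).
Proof.
elim/quotW=> r; exists (tofrac \n_r), (tofrac \d_r).
have d0 : tofrac \d_r != 0 :> {fraction D}.
  by rewrite tofrac_eq0 denom_ratioP.
split=> //; [by exists \n_r | by exists \d_r | apply: (canRL (mulfK d0))].
change (FracField.mul (\pi r) (tofrac \d_r) = tofrac \n_r :> {fraction D}).
unlock FracField.tofrac; rewrite -FracField.pi_mul; apply/eqmodP.
by rewrite /= FracField.equivfE /FracField.mulf !numden_Ratio
  ?mulr1 ?mulf_neq0 ?oner_neq0 ?denom_ratioP // mulrC.
Qed.

(* Main.v *)
Require Import Defs.
From mathcomp Require Import all_boot all_order all_algebra.
From mathcomp Require Import boolp classical_sets.
From mathcomp Require Import ring.

Set Implicit Arguments.
Unset Strict Implicit.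
Unset Printing Implicit Defensive.

Import GRing.Theory.
Local Open Scope ring_scope.
Local Open Scope classical_set_scope.

(* Write R for the local ring and E = (M : M).  In both directions
   (R : E) = M, so (R : J) = (M : J) for every E-ideal J, and divisoriality of
   J means (M : (M : J)) = J.  If R is divisorial, then E = (R : M) as M is not
   principal, so E is a minimal proper overmodule of R.
   Conversely, E <> R because R is not a valuation domain, so E / M is a plane
   over R / M.  It remains to see that every ideal I of R is principal or an
   E-module.  Either some y in (E : I) has yEI + M = E, and then yI is squeezed
   between M and E; or a single proper E-ideal N containing M satisfies
   (E : I) = (N : I), which dualizes to MI = (M : N)I, and E = R + (M : N). *)

(** * Submodules, colons and products inside a field *)

Section Submodules.
Variable K : fieldType.
Implicit Types (R I J N G : set K) (x y : K).

Definition subring R : Prop :=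
  [/\ R 1, forall x y, R x -> R y -> R (x - y)
    & forall x y, R x -> R y -> R (x * y)].

Lemma submod0 R I : submodule R I -> I 0. Proof. by case. Qed.

Lemma submodD R I x y : submodule R I -> I x -> I y -> I (x + y).
Proof. by case=> _ + _; apply. Qed.

Lemma submodZ R I r x : submodule R I -> R r -> I x -> I (r * x).
Proof. by case=> _ _; apply. Qed.

Lemma subring_submodule R : subring R -> submodule R R.
Proof.
case=> R1 RB RM; have R0 : R 0 by rewrite -(subrr 1); exact: RB.
split=> // x y Rx Ry; rewrite -[y]opprK -[- y]sub0r.
by apply/RB => //; exact: RB.
Qed.

Lemma submodN R I x : subring R -> submodule R I -> I x -> I (- x).
Proof.
move=> hR hI Ix; rewrite -mulN1r; apply: (submodZ hI) => //.
have [R1 RB _] := hR; rewrite -sub0r; apply: RB => //.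
exact: submod0 (subring_submodule hR).
Qed.

Lemma submodB R I x y : subring R -> submodule R I -> I x -> I y -> I (x - y).
Proof. by move=> hR hI Ix Iy; apply: (submodD hI) => //; exact: submodN hI Iy. Qed.

Lemma submodule_sub R R' I : R `<=` R' -> submodule R' I -> submodule R I.
Proof. by move=> sRR' [I0 ID IM]; split=> // r x /sRR'; exact: IM. Qed.

Lemma submodule_nz R I : submodule R I -> I <> [set 0] ->
  exists2 x, I x & x != 0.
Proof.
move=> hI; apply: contra_notP => hI0; apply/seteqP; split=> x.
  by move=> Ix; apply: contra_notP hI0 => /eqP x0; exists x.
by move=> ->; exact: submod0 hI.
Qed.

Lemma nz_neq0 I x : I x -> x != 0 -> I <> [set 0].
Proof. by move=> + + I0; rewrite I0 => -> /eqP. Qed.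

Lemma colon_submodule R I J : submodule R I -> submodule R (colon I J).
Proof.
move=> hI; split=> [y _|x y hx hy z Jz|r x Rr hx z Jz].
- by rewrite mul0r; exact: submod0 hI.
- by rewrite mulrDl; apply: (submodD hI); [exact: hx | exact: hy].
- by rewrite -mulrA; apply: (submodZ hI) => //; exact: hx.
Qed.

Lemma sub_colon_colon I J : J `<=` colon I (colon I J).
Proof. by move=> x Jx y; rewrite mulrC; apply. Qed.

Lemma colonS I J J' : J `<=` J' -> colon I J' `<=` colon I J.
Proof. by move=> sJ x hx y /sJ; exact: hx. Qed.

Lemma colon_subring R M : submodule R M -> subring R -> subring (colon M M).
Proof.
move=> hM hR; split=> [y|x y hx hy z Mz|x y hx hy z Mz]; first by rewrite mul1r.
  by rewrite mulrBl; apply: (submodB hR hM); [exact: hx | exact: hy].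
by rewrite -mulrA; exact/hx/hy.
Qed.

Lemma self_colon_submodule R M : submodule R M -> submodule (colon M M) M.
Proof. by case=> M0 MD _; split=> // r x; apply. Qed.

Lemma smallest_submodule R G : submodule R (smallest (submodule R) G).
Proof.
split=> [S [hS _]|x y hx hy S hS|r x Rr hx S hS].
- exact: submod0 hS.
- by apply: (submodD hS.1); [exact: hx | exact: hy].
- by apply: (submodZ hS.1) => //; exact: hx.
Qed.

Lemma add_submodule R I J : submodule R I -> submodule R J ->
  submodule R [set x + y | x in I & y in J].
Proof.
move=> hI hJ; split.
- by exists 0; [exact: submod0 hI|exists 0; [exact: submod0 hJ|rewrite addr0]].
- move=> _ _ [x Ix [y Jy <-]] [z Iz [t Jt <-]]; exists (x + z).
    exact: submodD hI Ix Iz.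
  by exists (y + t); [exact: submodD hJ Jy Jt | ring].
- move=> r _ Rr [x Ix [y Jy <-]]; exists (r * x); first exact: submodZ hI Rr Ix.
  by exists (r * y); [exact: submodZ hJ Rr Jy | ring].
Qed.

Lemma image_mul_submodule R J c : submodule R J -> submodule R [set y * c | y in J].
Proof.
move=> hJ; split.
- by exists 0; [exact: submod0 hJ | rewrite mul0r].
- move=> _ _ [y Jy <-] [z Jz <-].
  by exists (y + z); [exact: submodD hJ Jy Jz | rewrite mulrDl].
- move=> r _ Rr [y Jy <-].
  by exists (r * y); [exact: submodZ hJ Rr Jy | rewrite mulrA].
Qed.

Lemma preim_mul_submodule R I c : submodule R I -> submodule R [set x | I (c * x)].
Proof.
move=> hI; split=> /= [|x y Ix Iy|r x Rr Ix].
- by rewrite mulr0; exact: submod0 hI.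
- by rewrite mulrDr; exact: submodD hI Ix Iy.
- by rewrite mulrCA; exact: submodZ hI Rr Ix.
Qed.

(** The product [IJ]. Taking the smallest submodule through all [x * y] avoids finite sums: an
    inclusion need only be checked on the products. *)
Definition mulset R I J := smallest (submodule R) [set x * y | x in I & y in J].

Lemma mulset_in R I J x y : I x -> J y -> mulset R I J (x * y).
Proof. by move=> Ix Jy; apply: sub_gen_smallest; exists x => //; exists y. Qed.

Lemma mulset_sub R I J N : submodule R N ->
  (forall x y, I x -> J y -> N (x * y)) -> mulset R I J `<=` N.
Proof.
move=> hN h; apply: smallest_sub => // _ [x Ix [y Jy <-]]; exact: h.
Qed.

(** Multiplication by [R'] can be absorbed into the factor [I]. Thus [NI] is an [E]-module as soon
    as [N] is, even if [I] is only an [R]-module. *)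
Lemma mulset_submodule R R' I J : submodule R' I -> submodule R' (mulset R I J).
Proof.
move=> hI; have hS := smallest_submodule R [set x * y | x in I & y in J].
split=> [||e x Re]; [exact: submod0 hS | by move=> x y; exact: submodD hS |].
apply: (mulset_sub (N := [set x | mulset R I J (e * x)])).
  exact: preim_mul_submodule.
by move=> a b Ia Jb /=; rewrite mulrA; apply: mulset_in => //; exact: submodZ hI Re Ia.
Qed.

Lemma colon_mulset R I J N : submodule R N ->
  colon N (mulset R I J) = colon (colon N I) J.
Proof.
move=> hN; apply/seteqP; split=> [x hx y Jy z Iz|x hx y].
  by rewrite -mulrA (mulrC y); apply: hx; exact: mulset_in.
apply: (mulset_sub (N := [set y | N (x * y)])).
  exact: preim_mul_submodule.
by move=> a b Ia Jb /=; rewrite (mulrC a) mulrA; exact: hx.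
Qed.

(** * Maximal ideals and units of a local ring *)

Lemma maximal_not1 R M : subring R -> maximal_ideal R M -> ~ M 1.
Proof.
move=> [R1 RB RM] [[MR hM] MneR _] M1; apply: MneR; apply/seteqP; split=> //.
by move=> x Rx; rewrite -[x]mulr1; exact: submodZ hM Rx M1.
Qed.

Lemma proper_sub_maximal R I : subring R -> ideal R I -> ~ I 1 ->
  exists2 N, maximal_ideal R N & I `<=` N.
Proof.
move=> hR [sIR hI] I1; have [R1 _ _] := hR.
pose P X := X = set0 \/ [/\ ideal R X, I `<=` X & ~ X 1].
have [F FP Ftot|N [PN Nmax]] := @Zorn_bigcup K P.
  have [[X0 FX0 X0n]|Fe] := pselect (exists2 X, F X & X <> set0); last first.
    left; rewrite -subset0 => x [X FX Xx]; apply: Fe; exists X => //.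
    by move=> Xe; rewrite Xe in Xx.
  have [//|[[_ hX0] sIX0 _]] := FP _ FX0.
  have FPx X x : F X -> X x -> [/\ ideal R X, I `<=` X & ~ X 1].
    by move=> FX Xx; have [Xe|//] := FP _ FX; rewrite Xe in Xx.
  right; split=> [|x Ix|[X FX X1]]; last by have [_ _] := FPx _ _ FX X1.
    split=> [x [X FX Xx]|].
      by have [[sXR _] _ _] := FPx _ _ FX Xx; exact: sXR.
    split=> [|x y [X FX Xx] [Y FY Yy]|r x Rr [X FX Xx]].
    - by exists X0 => //; exact: submod0 hX0.
    - have [[_ hX] _ _] := FPx _ _ FX Xx; have [[_ hY] _ _] := FPx _ _ FY Yy.
      have [sXY|sYX] := Ftot _ _ FX FY.
        by exists Y => //; apply: (submodD hY) => //; exact: sXY.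
      by exists X => //; apply: (submodD hX) => //; exact: sYX.
    - have [[_ hX] _ _] := FPx _ _ FX Xx.
      by exists X => //; exact: submodZ hX Rr Xx.
  by exists X0 => //; exact: sIX0.
case: PN => [Ne|[hN sIN N1]].
  exfalso; apply: (Nmax I); last by right; split.
  by rewrite Ne; split=> [x []|/(_ 0 (submod0 hI)) []].
exists N => //; split=> // [NR|J hJ sNJ]; first by apply: N1; rewrite NR.
have [J1|J1] := pselect (J 1).
  right; apply/seteqP; split; first exact: hJ.1.
  by move=> x Rx; rewrite -[x]mulr1; exact: submodZ hJ.2 Rx J1.
left; apply: contrapT => JN; apply: (Nmax J).
  by split=> // sJN; apply: JN; apply/seteqP; split.
by right; split=> //; exact: subset_trans sNJ.
Qed.

(** If [x] is not a unit, [Rx] is proper and lies in a maximal ideal, which is [M] by uniqueness. *)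
Lemma local_inv R M x : subring R -> local_domain R -> maximal_ideal R M ->
  R x -> ~ M x -> R x^-1.
Proof.
move=> hR [M0 [_ uM0]] hM Rx; apply: contra_notP => Rx1.
have [R1 _ RM] := hR.
have [|[r Rr rx1]|N hN sIN] := @proper_sub_maximal R [set r * x | r in R] hR.
- split; last exact/image_mul_submodule/subring_submodule.
  by move=> _ [r Rr <-]; exact: RM.
- apply: Rx1; have x0 : x != 0.
    by apply: contra_eqN rx1 => /eqP ->; rewrite mulr0 eq_sym oner_eq0.
  by rewrite (@mulr1_eq _ x r) // mulrC.
- by rewrite -(uM0 _ hM) (uM0 _ hN); apply: sIN; exists 1 => //; rewrite mul1r.
Qed.

End Submodules.

Section LocalDomain.
Variables (K : fieldType) (R M : set K).
Hypothesis hR : subring R.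
Hypothesis hM : ideal R M.
Hypothesis M1 : ~ M 1.
Hypothesis Rinv : forall x, R x -> ~ M x -> R x^-1.
Hypothesis Mnp : ~ principal R M.

Let E := colon M M.
Let R1 : R 1. Proof. by case: hR. Qed.
Let RM x y : R x -> R y -> R (x * y). Proof. by case: hR => _ _; exact. Qed.
Let hRR : submodule R R. Proof. exact: subring_submodule. Qed.
Let MR : M `<=` R. Proof. by case: hM. Qed.
Let hMR : submodule R M. Proof. by case: hM. Qed.
Let hE : subring E. Proof. exact: colon_subring hMR hR. Qed.
Let hEE : submodule E E. Proof. exact: subring_submodule. Qed.
Let hME : submodule E M. Proof. exact: self_colon_submodule hMR. Qed.
Let RE : R `<=` E. Proof. exact: ideal_colon_overring. Qed.
Let ME : M `<=` E. Proof. exact: subset_trans MR RE. Qed.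
Let hER : submodule R E. Proof. exact: submodule_sub RE hEE. Qed.
Let E1 : E 1. Proof. exact: RE. Qed.

Lemma nonprincipal_nz : exists2 m, M m & m != 0.
Proof.
apply: submodule_nz hMR _ => M0; apply: Mnp; exists 0; first exact: submod0 hRR.
rewrite M0; apply/seteqP; split=> [x ->|x [r _ <-]]; last by rewrite mulr0.
by exists 1; rewrite ?mulr0.
Qed.

Lemma unitM m : M m -> R (1 - m)^-1.
Proof.
move=> Mm; apply: Rinv; first exact: (submodB hR hRR R1 (MR Mm)).
by move=> h; apply: M1; rewrite -(subrK m 1); exact: submodD hMR h Mm.
Qed.

Lemma onesubM_neq0 m : M m -> 1 - m != 0.
Proof. by move=> Mm; rewrite subr_eq0; apply: contra_notN M1 => /eqP ->. Qed.

(** * Consequences of divisoriality of [R] *)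

Section Divisorial.
Hypothesis hdiv : divisorial_domain R.

(** Multiplication by [c] carries [J] to an ideal of [R], and carries the v-closure along. *)
Lemma divisorial_fractional J c : submodule R J -> J <> [set 0] ->
  c != 0 -> (forall x, J x -> R (c * x)) -> v_closure R J = J.
Proof.
move=> hJ J0 c0 cJ; have [j Jj j0] := submodule_nz hJ J0.
apply/seteqP; split=> x; last exact: sub_colon_colon.
suff: [set y * c | y in J] (x * c) -> J x.
  have -> : [set y * c | y in J] = v_closure R [set y * c | y in J].
    apply: hdiv; last exact: nz_neq0 (imageP ( *%R^~ c) Jj) (mulf_neq0 j0 c0).
    split; last exact: image_mul_submodule.
    by move=> _ [y Jy <-]; rewrite mulrC; exact: cJ.
  move=> h hx; apply: h => y hy; rewrite -mulrA; apply: hx => z Jz.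
  by rewrite -mulrA mulrCA (mulrC c); apply: hy; exists z.
by move=> [y Jy /(mulIf c0) <-].
Qed.

(** If [xM] lies in [R] but [x * y] is outside [M] for some [y] in [M], then [x * y] is a unit and
    [z = (x * z) / (x * y) * y] shows that [y] generates [M]. *)
Lemma inv_maximal : colon R M = E.
Proof.
apply/seteqP; split=> x hx y My; last exact/MR/hx.
apply: contra_notP Mnp => Mxy; have Rxy := Rinv (hx _ My) Mxy.
have xy0 : x * y != 0 by apply: contra_notN Mxy => /eqP ->; exact: submod0 hMR.
exists y; first exact: MR.
apply/seteqP; split=> [z Mz|_ [r Rr <-]]; last exact: submodZ hMR Rr My.
exists ((x * z) * (x * y)^-1); first exact: RM (hx _ Mz) Rxy.
by move: xy0; rewrite mulf_eq0 negb_or => /andP[x0 y0]; field; rewrite x0 y0.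
Qed.

Lemma inv_self_colon : colon R E = M.
Proof.
have [m Mm m0] := nonprincipal_nz.
by rewrite -inv_maximal; symmetry; apply: hdiv hM (nz_neq0 Mm m0).
Qed.

Lemma self_colon_not_sub : ~ E `<=` R.
Proof.
by move=> ER; apply: M1; rewrite -inv_self_colon => x /ER; rewrite mul1r.
Qed.

(** For any [x] in [E] outside [R], [L = R + Rx] is all of [E]. A [z] in [(R : L)] lies in [R], and
    it lies in [M], since a unit [z] would put [x] in [R]. So [E] is contained in
    [(R : (R : L)) = L]. *)
Lemma self_colon_two_generated : two_generated R E.
Proof.
have [m Mm m0] := nonprincipal_nz.
have [x Ex Rx] : exists2 x, E x & ~ R x.
  by apply: contra_notP self_colon_not_sub => h x Ex; apply: contra_notP h; exists x.
pose L := [set r * 1 + s * x | r in R & s in R].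
have hL : submodule R L.
  have -> : L = [set a + b | a in [set r * 1 | r in R] & b in [set s * x | s in R]].
    apply/seteqP; split=> [_ [r Rr [s Rs <-]]|_ [_ [r Rr <-] [_ [s Rs <-] <-]]].
      by exists (r * 1); [exists r | exists (s * x) => //; exists s].
    by exists r => //; exists s.
  by apply: add_submodule; exact: image_mul_submodule.
have LE : L `<=` E.
  move=> _ [r Rr [s Rs <-]]; apply: (submodD hER); exact: submodZ hER _ _.
have L1 : L 1.
  by exists 1 => //; exists 0; [exact: submod0 hRR | rewrite mul0r mulr1 addr0].
have Lx : L x.
  by exists 0; [exact: submod0 hRR | exists 1 => //; rewrite mul0r mul1r add0r].
exists 1, x; rewrite -/L; apply/seteqP; split=> // e Ee.
rewrite -(@divisorial_fractional L m) //; last 2 first.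
- exact: nz_neq0 L1 (oner_neq0 _).
- by move=> y /LE Ey; rewrite mulrC; exact/MR/Ey.
move=> z hz; apply/MR/Ee; apply: contra_notP Rx => Mz.
have Rz : R z by rewrite -[z]mulr1; exact: hz.
have z0 : z != 0 by apply: contra_notN Mz => /eqP ->; exact: submod0 hMR.
by rewrite -[x](mulKf z0); apply: RM (Rinv Rz Mz) (hz _ Lx).
Qed.

(** If [yJ] lies in [R] and [J] is an [E]-module, then [yJ] lies in [(R : E) = M]. Hence
    [(M : (M : J))] lies in the v-closure of [J], which is [J]. *)
Lemma maximal_m_canonical : m_canonical E M.
Proof.
have [m Mm m0] := nonprincipal_nz.
split=> // [|J [JE hJ] J0]; first exact: nz_neq0 Mm m0.
apply/seteqP; split=> x; last exact: sub_colon_colon.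
move=> hx; rewrite -(@divisorial_fractional J m) //; last 2 first.
- exact: submodule_sub RE hJ.
- by move=> j /JE Ej; rewrite mulrC; exact/MR/Ej.
move=> y hy; apply/MR/hx => j Jj; rewrite -inv_self_colon => e Ee.
by rewrite -mulrA (mulrC j); apply: hy; exact: submodZ hJ Ee Jj.
Qed.

End Divisorial.

(** * Consequences of [M] being m-canonical in a 2-generated [E] *)

Section MCanonical.
Hypothesis hqf : has_quotient_field R.
Hypothesis hnv : ~ valuation_domain R.
Hypothesis h2 : two_generated R E.
Hypothesis hmc : m_canonical E M.

Lemma dual_dual J : ideal E J -> J <> [set 0] -> colon M (colon M J) = J.
Proof. by case: hmc => _ _; apply. Qed.

(* Otherwise take [a], [b] incomparable and [J = (a, b)]: no [y] with
   [ya, yb] in [R] makes [ya] or [yb] a unit, so [(M : MJ) = (M : J)], hence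
   [MJ = J], against Nakayama. *)
Lemma m_canonical_not_sub : ~ E `<=` R.
Proof.
move=> ER; apply: hnv => x x0; apply: contrapT => /not_orP[Rx Rx1].
have [a [b [Ra Rb b0 xab]]] := hqf x.
have a0 : a != 0 by apply: contra_neq x0 => a0; rewrite xab a0 mul0r.
(* This [J] is [Ma + Mb], the product of [M] with the ideal generated by [a] and [b]. Duality puts
   [a] in it, say [a = n * a + p * b], and then [x = p / (1 - n)] is in [R]. *)
pose J := [set r + s | r in [set r * a | r in M] & s in [set s * b | s in M]].
have lineE c : submodule E [set r * c | r in M] by exact: image_mul_submodule.
have hJ : submodule E J by apply: add_submodule.
have [m Mm m0] := nonprincipal_nz.
have Ja n : M n -> J (n * a).
  move=> Mn; exists (n * a); first by exists n.
  by exists 0; [exact: submod0 (lineE b) | rewrite addr0].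
have Jb n : M n -> J (n * b).
  move=> Mn; exists 0; first exact: submod0 (lineE a).
  by exists (n * b); [exists n | rewrite add0r].
have JE : J `<=` E.
  move=> _ [_ [r Mr <-] [_ [s Ms <-] <-]].
  by apply: (submodD hEE); rewrite mulrC; apply: submodZ hEE _ _; auto.
have : J a.
  rewrite -(@dual_dual J) //; last exact: nz_neq0 (Ja _ Mm) (mulf_neq0 m0 a0).
  move=> y hy.
  have Rya : R (y * a) by apply: ER => n Mn; rewrite mulrAC -mulrA; apply: hy; apply: Ja.
  have Ryb : R (y * b) by apply: ER => n Mn; rewrite mulrAC -mulrA; apply: hy; apply: Jb.
  rewrite mulrC; apply: contra_notP Rx1 => Mya; have Ru := Rinv Rya Mya.
  have y0 : y != 0.
    by apply: contra_notN Mya => /eqP ->; rewrite mul0r; exact: submod0 hMR.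
  have -> : x^-1 = (y * b) * (y * a)^-1 by rewrite xab; field; rewrite a0 y0.
  exact: RM.
move=> [_ [n Mn <-] [_ [p Mp <-] e]]; apply: Rx.
have -> : x = p * (1 - n)^-1.
  have n1 := onesubM_neq0 Mn; rewrite xab; apply/eqP; rewrite eqr_div //; apply/eqP.
  by rewrite mulrBr mulr1 -{1}e; ring.
by apply: RM; [exact: MR | exact: unitM].
Qed.

(** An element of [(R : E)] outside [M] is a unit of [R], which would force [E] into [R]. *)
Lemma inv_self_colon_mc : colon R E = M.
Proof.
apply/seteqP; split=> x hx; last by move=> e Ee; rewrite mulrC; exact/MR/Ee.
have Rx : R x by rewrite -[x]mulr1; exact: hx.
apply: contra_notP m_canonical_not_sub => Mx e Ee.
have x0 : x != 0 by apply: contra_notN Mx => /eqP ->; exact: submod0 hMR.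
by rewrite -[e](mulKf x0); apply: RM (Rinv Rx Mx) (hx _ Ee).
Qed.

(* Steinitz exchange: [E / M] has dimension at most 2 over the field [R / M]. *)
Lemma two_dim (A B : set K) x1 x2 : submodule R A -> submodule R B ->
  M `<=` A -> A `<=` B -> B `<=` E -> A x1 -> ~ M x1 -> B x2 -> ~ A x2 -> E `<=` B.
Proof.
move=> hA hB sMA sAB sBE Ax1 Mx1 Bx2 Ax2.
(* As [x1] is outside [M], one of its two coefficients is a unit; by symmetry in the generators let
   it be that of [a]. Then [x1] replaces [a]. *)
suff key a b : E = [set r * a + s * b | r in R & s in R] ->
    forall r s, R r -> R s -> x1 = r * a + s * b -> ~ M r -> E `<=` B.
  have [a [b Eab]] := h2; have := sBE _ (sAB _ Ax1).
  rewrite Eab => -[r Rr [s Rs x1E]].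
  have [Mr|Mr] := pselect (M r); last by rewrite -Eab; exact: (key a b _ r s).
  rewrite -Eab; apply: (key b a _ s r) => //; last 2 first.
  - by rewrite addrC.
  - move=> Ms; apply: Mx1; rewrite -x1E.
    have [Ea Eb] : E a /\ E b.
      rewrite Eab; split.
        by exists 1 => //; exists 0; [exact: submod0 hRR | rewrite mul1r mul0r addr0].
      by exists 0; [exact: submod0 hRR | exists 1 => //; rewrite mul1r mul0r add0r].
    by apply: (submodD hMR); rewrite mulrC; [exact: Ea | exact: Eb].
  rewrite Eab; apply/seteqP; split=> _ [p Rp [q Rq <-]]; exists q => //; exists p => //;
  by rewrite addrC.
move=> Eab r s Rr Rs x1E Mr; have Rri := Rinv Rr Mr.
have r0 : r != 0 by apply: contra_notN Mr => /eqP ->; exact: submod0 hMR.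
have Eb : E b.
  rewrite Eab; exists 0; first exact: submod0 hRR.
  by exists 1 => //; rewrite mul1r mul0r add0r.
have aE : a = r^-1 * x1 - (r^-1 * s) * b by rewrite x1E; field.
have gen e : E e -> exists p q, [/\ R p, R q & e = p * x1 + q * b].
  rewrite {1}Eab => -[p Rp [q Rq <-]]; exists (p * r^-1), (q - p * (r^-1 * s)).
  split; first exact: RM.
    by apply: (submodB hR hRR) => //; do 2?apply: RM.
  by rewrite aE; ring.
have [p [q [Rp Rq x2E]]] := gen _ (sBE _ Bx2).
(* If [q] were in [M], then [q * b] would be in [M], hence in [A], and so would [x2]. So [x2] can
   replace [b]. *)
have Mq : ~ M q.
  move=> Mq; apply: Ax2; rewrite x2E; apply: (submodD hA); first exact: submodZ hA Rp Ax1.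
  by apply: sMA; rewrite mulrC; exact: Eb.
have q0 : q != 0 by apply: contra_notN Mq => /eqP ->; exact: submod0 hMR.
have Bx1 := sAB _ Ax1.
have Bb : B b.
  have -> : b = q^-1 * (x2 - p * x1) by rewrite x2E; field.
  apply: (submodZ hB); first exact: Rinv.
  by apply: (submodB hR hB) => //; exact: submodZ hB Rp Bx1.
move=> e /gen[p' [q' [Rp' Rq' ->]]].
by apply: (submodD hB); [exact: submodZ hB Rp' Bx1 | exact: submodZ hB Rq' Bb].
Qed.

(** * Divisoriality of a fixed nonzero ideal [I] of [R] *)

Section Ideal.
Variable I : set K.
Hypothesis hI : ideal R I.
Hypothesis I0 : I <> [set 0].

Let IR : I `<=` R. Proof. by case: hI. Qed.
Let hIR : submodule R I. Proof. by case: hI. Qed.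
Let IE : I `<=` E. Proof. exact: subset_trans IR RE. Qed.

(** [((M : N) : I)] is the dual [(M : NI)], and [NI] is a nonzero [E]-ideal, so it equals its double
    dual. *)
Lemma dual_mulset (N : set K) : submodule E N -> N `<=` E -> N <> [set 0] ->
  colon M (colon (colon M N) I) = mulset R N I.
Proof.
move=> hN NE N0; rewrite -(@colon_mulset _ R) // dual_dual //.
  split; last exact: mulset_submodule.
  by apply: mulset_sub => // x y Nx Iy; apply: submodZ hEE _ _; auto.
have [n Nn n0] := submodule_nz hN N0; have [i Ii i0] := submodule_nz hIR I0.
exact: nz_neq0 (mulset_in Nn Ii) (mulf_neq0 n0 i0).
Qed.

(* Dualizing [(E : I) = (N : I)] gives [MI = (M : N)I], while [E = R + (M : N)]. *)
Lemma stable_of_colon (N : set K) : ideal E N -> M `<=` N -> ~ N 1 ->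
  colon E I `<=` colon N I -> forall e i, E e -> I i -> I (e * i).
Proof.
move=> [NE hN] MN N1 sEN.
have [m Mm m0] := nonprincipal_nz; have N0 := nz_neq0 (MN _ Mm) m0.
pose N' := colon M N.
have hN' : submodule E N' by exact: colon_submodule.
have N'E : N' `<=` E by exact: colonS.
have MN' : M `<=` N' by move=> x Mx y Ny; rewrite mulrC; exact: NE.
have NI : mulset R N' I = mulset R M I.
  rewrite -!dual_mulset //; try exact: nz_neq0 Mm m0; last exact: nz_neq0 (MN' _ Mm) m0.
  congr colon; rewrite /N' dual_dual //; apply/seteqP; split=> // x hx i Ii.
  exact/NE/hx.
have MI : mulset R M I `<=` I.
  by apply: mulset_sub => // x y Mx Iy; apply: submodZ hIR _ _; auto.
have N'I x i : N' x -> I i -> I (x * i).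
  by move=> Nx Ii; apply: MI; rewrite -NI; exact: mulset_in.
(* If [N'] were inside [M], then 1 would lie in [(M : N') = N]. *)
have [x1 Nx1 Mx1] : exists2 x1, N' x1 & ~ M x1.
  apply: contra_notP N1 => h; rewrite -(dual_dual (conj NE hN) N0) => y Ny.
  by rewrite mul1r; apply: contra_notP h => My; exists y.
(* When 1 is not in [N'], the chain from [M] to [N'] to [R + N'] is strict, so it exhausts
   [E / M]. *)
have sEB : E `<=` [set r + n | r in R & n in N'].
  have sN'B : N' `<=` [set r + n | r in R & n in N'].
    by move=> n Nn; exists 0; [exact: submod0 hRR | exists n; rewrite ?add0r].
  have [N'1|N'1] := pselect (N' 1).
    by move=> e Ee; apply: sN'B; rewrite -[e]mulr1; exact: submodZ hN' Ee N'1.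
  apply: (@two_dim N' _ x1 1) => //.
  - exact: submodule_sub RE hN'.
  - by apply: add_submodule => //; exact: submodule_sub RE hN'.
  - by move=> _ [r Rr [n Nn <-]]; apply: (submodD hEE); auto.
  - by exists 1 => //; exists 0; [exact: submod0 hN' | rewrite addr0].
move=> e i /sEB[r Rr [n Nn <-]] Ii; rewrite mulrDl; apply: (submodD hIR).
  exact: submodZ hIR Rr Ii.
exact: N'I.
Qed.

(** This is [yEI + M]. For [y] in [(E : I)] it is an ideal of [E], and [G y 1] says that it is all
    of [E]. *)
Let G (y : K) : set K := smallest (submodule E) (M `|` [set y * i | i in I]).

Let hG y : submodule E (G y). Proof. exact: smallest_submodule. Qed.
Let MG y : M `<=` G y. Proof. by move=> x Mx; apply: sub_gen_smallest; left. Qed.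
Let IG y i : I i -> G y (y * i).
Proof. by move=> Ii; apply: sub_gen_smallest; right; exists i. Qed.
Let G_sub y N : submodule E N -> M `<=` N -> (forall i, I i -> N (y * i)) ->
  G y `<=` N.
Proof.
by move=> hN MN h; apply: smallest_sub => // x [/MN //|[i Ii <-]]; exact: h.
Qed.

(** The module [yI] contains [M], strictly. By dimension it is either [E], so that [I] is an
    [E]-module, or [Ru + M]. In the latter case [u] is a unit of [E], so [M = uM] and [yI = Ru]. *)
Lemma principal_or_stable y : colon E I y -> G y 1 ->
  (exists2 a, a != 0 & I = [set r * a | r in R])
  \/ (forall e i, E e -> I i -> I (e * i)).
Proof.
move=> hy Gy1.
have y0 : y != 0.
  apply/eqP => y0; apply: M1; apply: (@G_sub y M) Gy1 => // i Ii.
  by rewrite y0 mul0r; exact: submod0 hMR.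
pose yI := [set x | I (y^-1 * x)].
have hyI : submodule R yI by exact: preim_mul_submodule.
have yIE : yI `<=` E by move=> x /hy; rewrite mulVKf.
have yIi i : I i -> yI (y * i) by move=> Ii; rewrite /yI /= mulKf.
(* Nakayama: [1] lies in [y E I + M], hence in [y E I]. *)
have MyI : M `<=` yI.
  (* Although [yI] is only an [R]-module, [(yI : M)] is an [E]-module because [EM] lies in [M]. It
     contains [yEI], hence some [1 - m], a unit of [R]. *)
  have hJ : submodule E (colon yI M).
    split; [|move=> a b ha hb|move=> e a Ee ha] => n Mn.
    - by rewrite mul0r; exact: submod0 hyI.
    - by rewrite mulrDl; apply: (submodD hyI); [exact: ha | exact: hb].
    - by rewrite mulrAC mulrC; apply/ha/Ee.
  have [m [Mm hm]] : exists m, M m /\ colon yI M (1 - m).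
    apply: (@G_sub y [set x | exists m, M m /\ colon yI M (x - m)]) Gy1.
    - split.
      + by exists 0; split; [exact: submod0 hMR | rewrite subrr; exact: submod0 hJ].
      + move=> a b [m [Mm ha]] [n [Mn hb]]; exists (m + n); split.
          exact: submodD hMR Mm Mn.
        by rewrite opprD addrACA; exact: submodD hJ ha hb.
      + move=> e a Ee [m [Mm ha]]; exists (e * m); split; first exact: Ee.
        by rewrite -mulrBr; exact: submodZ hJ Ee ha.
    - by move=> m Mm; exists m; split=> //; rewrite subrr; exact: submod0 hJ.
    - move=> i Ii; exists 0; split; first exact: submod0 hMR.
      rewrite subr0 => n Mn; rewrite mulrC.
      by apply: (submodZ hyI); [exact: MR | exact: yIi].
  move=> n Mn; have -> : n = (1 - m) * ((1 - m)^-1 * n).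
    by rewrite mulVKf // onesubM_neq0.
  by apply: hm; apply: submodZ hMR (unitM Mm) Mn.
have [u yIu Mu] : exists2 u, yI u & ~ M u.
  apply: contra_notP M1 => h; apply: (@G_sub y M) Gy1 => // i Ii.
  by apply: contra_notP h => Mi; exists (y * i) => //; exact: yIi.
pose A := [set r + m | r in [set r * u | r in R] & m in M].
have hA : submodule R A by apply: add_submodule => //; exact: image_mul_submodule.
have MA : M `<=` A.
  move=> m Mm; exists 0; first exact: submod0 (image_mul_submodule u hRR).
  by exists m; rewrite ?add0r.
have Au : A u.
  exists u; first by exists 1; rewrite ?mul1r.
  by exists 0; [exact: submod0 hMR | rewrite addr0].
have AyI : A `<=` yI.
  move=> _ [_ [r Rr <-] [m Mm <-]]; apply: (submodD hyI); last exact: MyI.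
  exact: submodZ hyI Rr yIu.
have [yIA|] := pselect (yI `<=` A); last first.
  move=> h; have [x yIx Ax] : exists2 x, yI x & ~ A x.
    by apply: contra_notP h => h x yIx; apply: contra_notP h; exists x.
  have EyI : E `<=` yI := two_dim hA hyI MA AyI yIE Au Mu yIx Ax.
  right=> e i Ee Ii; rewrite -[e * i](mulKf y0); apply: EyI.
  by rewrite mulrCA; apply: submodZ hEE Ee (hy _ Ii).
left; have Eu := yIE _ yIu.
(* As [yI] lies in [Ru + M], [G y] lies in [Eu + M]. So [e * u = 1 - m] is a unit of [R], which
   inverts [u] in [E]. *)
have [_ [e Ee <-] [m Mm e1]] :
    [set x + m | x in [set e * u | e in E] & m in M] 1.
  apply: (@G_sub y) Gy1.
  - by apply: add_submodule => //; exact: image_mul_submodule.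
  - move=> m Mm; exists 0; first exact: submod0 (image_mul_submodule u hEE).
    by exists m; rewrite ?add0r.
  - move=> i /yIi/yIA[_ [r Rr <-] [m Mm <-]]; exists (r * u); first by exists r; auto.
    by exists m.
have u0 : u != 0 by apply: contra_notN Mu => /eqP ->; exact: submod0 hMR.
have n1 := onesubM_neq0 Mm.
have Eui : E u^-1.
  have -> : u^-1 = (1 - m)^-1 * e.
    have -> : 1 - m = e * u by rewrite -e1 addrK.
    have e0 : e != 0.
      by apply: contra_neq n1 => e0; rewrite -e1 e0 mul0r add0r subrr.
    by field; rewrite e0 u0.
  by apply: submodZ hEE _ Ee; exact/RE/unitM.
exists (y^-1 * u); first by rewrite mulf_neq0 ?invr_eq0.
apply/seteqP; split=> [i Ii|_ [r Rr <-]]; last first.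
  by apply: (submodZ hIR) => //; exact: yIu.
have [_ [r Rr <-] [n Mn yi]] := yIA _ (yIi _ Ii).
exists (r + u^-1 * n).
  by apply: (submodD hRR) => //; exact/MR/Eui.
have -> : i = y^-1 * (r * u + n) by rewrite yi mulKf.
by field; rewrite y0 u0.
Qed.

(* The ideals [G y = yEI + M] lie between [M] and [E], and [E / M] has dimension
   2. If [G y1] and [G y2] are distinct and proper, they are comaximal, and
   [e1 + e2 = 1] with [ei] in [G yi] makes [G (e1 y1 + e2 y2)] the whole of [E]. *)
Lemma exists_colon_bound : (forall y, colon E I y -> ~ G y 1) ->
  exists N, [/\ ideal E N, M `<=` N, ~ N 1 & colon E I `<=` colon N I].
Proof.
move=> hG1.
have GE y : colon E I y -> G y `<=` E by move=> hy; exact: G_sub.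
have [h|h] := pselect (colon E I `<=` colon M I); first by exists M; split.
have [y1 [i1 [hy1 Ii1 Mi1]]] : exists y i, [/\ colon E I y, I i & ~ M (y * i)].
  apply: contra_notP h => h y hy i Ii; apply: contra_notP h => Mi.
  by exists y, i.
(* After [M], the next candidate for [N] is [G y1]; its failure yields [y2] with [G y2] not inside
   [G y1]. *)
have [h1|h1] := pselect (colon E I `<=` colon (G y1) I).
  by exists (G y1); split=> //; [split=> //; exact: GE | exact: hG1].
have [y2 [i2 [hy2 Ii2 Gi2]]] :
    exists y i, [/\ colon E I y, I i & ~ G y1 (y * i)].
  apply: contra_notP h1 => h1 y hy i Ii; apply: contra_notP h1 => Mi.
  by exists y, i.
exfalso; have hGR y : submodule R (G y) by exact: submodule_sub RE (hG y).
(* Otherwise [M], the intersection and [G y2] form a strict chain, which forces [G y2] to be [E]. *)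
have GGM x : G y1 x -> G y2 x -> M x.
  move=> x1 x2; apply: contra_notP (hG1 _ hy2) => Mx.
  apply: (@two_dim (G y1 `&` G y2) (G y2) x (y2 * i2)) => //.
  - split=> [|a b [a1 a2] [b1 b2]|r a Rr [a1 a2]].
    + by split; [exact: submod0 (hG y1) | exact: submod0 (hG y2)].
    + by split; [exact: submodD (hG y1) a1 b1 | exact: submodD (hG y2) a2 b2].
    + by split; [exact: submodZ (hGR y1) Rr a1 | exact: submodZ (hGR y2) Rr a2].
  - by move=> m Mm; split; exact: MG.
  - exact: GE.
  - exact: IG.
  - by case.
have [e1 Ge1 [e2 Ge2 e12]] : [set a + b | a in G y1 & b in G y2] 1.
  apply: (@two_dim (G y1) _ (y1 * i1) (y2 * i2)) => //.
  - exact: add_submodule.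
  - by move=> a Ga; exists a => //; exists 0; [exact: submod0 (hG y2) | rewrite addr0].
  - by move=> _ [a /(GE _ hy1) Ea [b /(GE _ hy2) Eb <-]]; exact: submodD hEE Ea Eb.
  - exact: IG.
  - by exists 0; [exact: submod0 (hG y1) | exists (y2 * i2); [exact: IG | rewrite add0r]].
have [Ee1 Ee2] := (GE _ hy1 _ Ge1, GE _ hy2 _ Ge2).
have GGM' a b : G y1 a -> G y2 b -> M (a * b).
  move=> Ga Gb; apply: GGM; last exact: submodZ (hG y2) (GE _ hy1 _ Ga) Gb.
  by rewrite mulrC; exact: submodZ (hG y1) (GE _ hy2 _ Gb) Ga.
have hy : colon E I (e1 * y1 + e2 * y2).
  by apply: (submodD (colon_submodule I hEE)); apply: (submodZ (colon_submodule I hEE)).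
set y := e1 * y1 + e2 * y2 in hy.
have e1E : e1 = 1 - e2 by rewrite -e12 addrK.
have G1 : G y1 `<=` G y.
  apply: G_sub => // i Ii.
  (* Modulo [M], [y1 * i] is [e1 * (y * i)]: the error terms come from [1 - e1 ^ 2 = e2 * (1 + e1)]
     and lie in [M], being multiples of products from [G y1] and [G y2]. *)
  have -> : y1 * i = e1 * (y * i) + ((y1 * i) * e2) * (1 + e1) - (y2 * i) * (e1 * e2).
    by rewrite /y e1E; ring.
  have [Ey1 Ey2] := (hy1 _ Ii, hy2 _ Ii).
  apply: (submodB hE (hG y)); last by apply: MG; apply: submodZ hME Ey2 _; exact: GGM'.
  apply: (submodD (hG y)); first by apply: (submodZ (hG y)) => //; exact: IG.
  apply: MG; rewrite mulrC; apply: (submodZ hME); first exact: submodD hEE E1 Ee1.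
  by apply: GGM' => //; exact: IG.
have G2 : G y2 `<=` G y.
  apply: G_sub => // i Ii.
  have -> : y2 * i = e2 * (y * i) + (e1 * (y2 * i)) * (1 + e2) - (y1 * i) * (e1 * e2).
    by rewrite /y e1E; ring.
  have [Ey1 Ey2] := (hy1 _ Ii, hy2 _ Ii).
  apply: (submodB hE (hG y)); last by apply: MG; apply: submodZ hME Ey1 _; exact: GGM'.
  apply: (submodD (hG y)); first by apply: (submodZ (hG y)) => //; exact: IG.
  apply: MG; rewrite mulrC; apply: (submodZ hME); first exact: submodD hEE E1 Ee2.
  by apply: GGM' => //; exact: IG.
by apply: (hG1 _ hy); rewrite -e12; apply: (submodD (hG y)); auto.
Qed.

(** If [y] is in [(M : I)], then [yE] lies in [(R : I)] because [EI = I]. For [x] in the v-closure,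
    [xyE] lies in [R], so [x * y] is in [(R : E) = M]; thus [x] is in the double [M]-dual of [I],
    which is [I]. *)
Lemma stable_divisorial : (forall e i, E e -> I i -> I (e * i)) -> divisorial R I.
Proof.
move=> EI; have hIE : submodule E I.
  by split; [exact: submod0 hIR | move=> x y; exact: submodD hIR | exact: EI].
apply/seteqP; split=> x hx; first exact: sub_colon_colon.
rewrite -(dual_dual (conj IE hIE) I0) => y hy; rewrite -inv_self_colon_mc => e Ee.
rewrite -mulrA; apply: hx => i Ii; apply: MR.
by rewrite -mulrA; apply: hy; exact: EI.
Qed.

Lemma principal_divisorial a : a != 0 -> I = [set r * a | r in R] -> divisorial R I.
Proof.
move=> a0 Ia; apply/seteqP; split=> x hx; first exact: sub_colon_colon.
rewrite Ia; exists (x * a^-1); last by rewrite mulfVK.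
by apply: hx => i; rewrite Ia => -[r Rr <-]; rewrite mulrC mulfK.
Qed.

Lemma m_canonical_divisorial : divisorial R I.
Proof.
have [[y [hy Gy1]]|h] := pselect (exists y, colon E I y /\ G y 1).
  have [[a a0 Ia]|EI] := principal_or_stable hy Gy1; last exact: stable_divisorial.
  exact: principal_divisorial Ia.
have [y hy Gy1|N [hN MN N1 sN]] := exists_colon_bound; first by apply: h; exists y.
by apply: stable_divisorial; exact: stable_of_colon sN.
Qed.

End Ideal.
End MCanonical.
End LocalDomain.

(** * Application to a domain inside its fraction field *)

Lemma in_frac_subring (D : idomainType) : subring (in_frac D).
Proof.
split=> [|_ _ [x _ <-] [y _ <-]|_ _ [x _ <-] [y _ <-]].
- by exists 1; rewrite ?rmorph1.
- by exists (x - y); rewrite ?rmorphB.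
- by exists (x * y); rewrite ?rmorphM.
Qed.

Theorem theorem1p2 (D : idomainType) (M : set {fraction D})
  (hlocal : local_domain (in_frac D))
  (hM : maximal_ideal (in_frac D) M)
  (hnp : ~ principal (in_frac D) M)
  (hnv : ~ valuation_domain (in_frac D)) :
  divisorial_domain (in_frac D) <->
  two_generated (in_frac D) (colon M M) /\ m_canonical (colon M M) M.
Proof.
have hR := in_frac_subring D; have [hMi _ _] := hM.
have M1 := maximal_not1 hR hM.
have Rinv x := @local_inv _ _ _ x hR hlocal hM.
split=> [hdiv|[h2 hmc] I hI I0].
  split; first exact: (self_colon_two_generated hR hMi M1 Rinv hnp hdiv).
  exact: (maximal_m_canonical hR hMi Rinv hnp hdiv).
have hqf := @in_frac_quotient_field D.
exact: (m_canonical_divisorial hR hMi M1 Rinv hnp hqf hnv h2 hmc hI I0).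
Qed.
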